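(* Let $p$ be an odd prime, let $C_p$ be the cycle graph on $p$ vertices with adjacency matrix $A$, and let $a,b$ be any (possibly equal) vertices. Then there is a region $R\subseteq\mathbb{C}$ such that the curve $t\mapsto \exp(\mathrm{i}tA)_{a,b}$, $t\ge 0$, is dense in $R$ (as $t\to\infty$), and $R$ is invariant under the rotation of the plane about the origin by angle $2\pi/p$ (that is, $R$ has $p$-fold rotational symmetry). *)

(* Defs.v *)
From HB Require Import structures.
From mathcomp Require Import all_boot all_order all_algebra.
From mathcomp Require Import all_classical all_reals all_analysis.
From mathcomp Require Import complex.
Set Implicit Arguments. Unset Strict Implicit. Unset Printing Implicit Defensive.
Import Order.TTheory GRing.Theory Num.Theory.
Import numFieldNormedType.Exports.
Local Open Scope ring_scope.
Local Open Scope classical_set_scope.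

(* The complex numbers over a real field R, with their canonical
   (norm-induced) topology: R[i]^o. *)
Definition cplx (R : realType) := (R[i])^o.

(* Matrix exponential, defined as the limit of the partial sums of the
   exponential series sum_k M^k / k! (matrices carry the entrywise/product
   topology of MathComp-Analysis). *)
Definition expmx (R : realType) (n : nat) (M : 'M[cplx R]_n) : 'M[cplx R]_n :=
  lim ((fun N : nat => \sum_(k < N) ((k`!)%:R)^-1 *: M ^+ k) @ \oo).

(* Adjacency matrix of the cycle graph C_n on vertex set 'I_n = {0,...,n-1}:
   i ~ j iff j = i+1 (mod n) or i = j+1 (mod n).  (For n >= 3 this is the
   usual simple cycle.) *)
Definition cycle_adj (R : realType) (n : nat) : 'M[cplx R]_n :=
  \matrix_(i < n, j < n)
    (((j : nat) == (i.+1 %% n)%N) || ((i : nat) == (j.+1 %% n)%N))%:R.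

Definition iC (R : realType) : cplx R := (0 +i* 1)%C.
Definition rotC (R : realType) (theta : R) (z : cplx R) : cplx R :=
  ((cos theta +i* sin theta)%C : cplx R) * z.

Definition walk_entry (R : realType) (n : nat) (A : 'M[cplx R]_n) (a b : 'I_n)
  (t : R) : cplx R :=
  expmx (((iC R) * ((t%:C)%C : cplx R)) *: A) a b.

(* Main.v *)
Require Import Defs.
From HB Require Import structures.
From mathcomp Require Import all_boot all_order all_algebra.
From mathcomp Require Import all_classical all_reals all_analysis.
From mathcomp Require Import complex.
From mathcomp Require Import ring lra.
Set Implicit Arguments. Unset Strict Implicit. Unset Printing Implicit Defensive.
Import Order.TTheory GRing.Theory Num.Theory.
Import numFieldNormedType.Exports.
Local Open Scope ring_scope.

(** With [w = exp(2 i pi / p)] and [theta_k = 2 cos (2 pi k / p)], the entry at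
time [t] is [1/p * \sum_k w^(k (a - b)) * exp(i t theta_k)].  If a time [u]
makes every [exp(i u theta_k)] close to [w], then waiting for [u] multiplies
the entry by [w] up to a small error, uniformly in [t]; waiting for [p u]
nearly restores it.  So the set of limit points of the curve as [t] goes to
infinity has all the required properties once such [u] exist and can be chosen
arbitrarily large.

This is a case of Kronecker's theorem: every integer relation
[\sum_k n_k theta_k = 0] must satisfy [\sum_k n_k = 0 mod p].  The relation
says that [w] is a root of [\sum_k n_k (X^k + X^(p-k))], which is therefore
divisible by the [p]-th cyclotomic polynomial; evaluating at [1] gives
[p %| 2 \sum_k n_k], and [p] is odd. *)

(** * Integer polynomials vanishing at a root of unity of prime order *)

(* [((X + 1)^p - 1) / X], i.e. the p-th cyclotomic polynomial at [X + 1]. *)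
Definition shifted_cyclotomic (p : nat) : {poly int} :=
  \poly_(i < p) ('C(p, i.+1))%:Z.

Lemma size_shifted_cyclotomic p : (0 < p)%N -> size (shifted_cyclotomic p) = p.
Proof. by move=> p0; apply: size_poly_eq; rewrite prednK // binn. Qed.

Lemma monic_shifted_cyclotomic p :
  (0 < p)%N -> shifted_cyclotomic p \is monic.
Proof.
move=> p0; rewrite monicE lead_coefE size_shifted_cyclotomic // coef_poly.
by rewrite prednK // leqnn binn.
Qed.

(** Eisenstein at [p]: the leading coefficient is 1, the constant one is [p], and [p] divides the
    binomials in between. *)
Lemma irreducible_shifted_cyclotomic p :
  prime p -> irreducible_poly (shifted_cyclotomic p).
Proof.
move=> pp; have p1 := prime_gt1 pp; have p0 := prime_gt0 pp.
apply: (eisenstein_crit pp).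
- by rewrite size_shifted_cyclotomic // neq_ltn p1 orbT.
- rewrite (eqP (monic_shifted_cyclotomic p0)).
  by rewrite dvdzE /= dvdn1 neq_ltn p1 orbT.
- rewrite coef_poly p0 bin1 dvdzE.
  have -> : `|p ^+ 2|%N = (p ^ 2)%N by rewrite -!mulnn.
  rewrite absz_nat -{2}[p]expn1.
  by rewrite dvdn_Pexp2l.
- move=> i; rewrite size_shifted_cyclotomic // => ip.
  have ip1 : (i.+1 < p)%N by rewrite -ltn_predRL.
  by rewrite coef_poly (ltnW ip1) dvdzE /= prime_dvd_bin.
Qed.

Lemma horner_shifted_cyclotomic (R : comNzRingType) p (x : R) :
  x * (map_poly intr (shifted_cyclotomic p)).[x] = (x + 1) ^+ p - 1.
Proof.
have -> : map_poly intr (shifted_cyclotomic p)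
          = \poly_(i < p) ('C(p, i.+1))%:R :> {poly R}.
  apply/polyP => i; rewrite coef_map_id0 ?mulr0z // !coef_poly.
  by case: ifP => // _; rewrite ?mulr0z.
rewrite horner_poly exprD1n big_ord_recl /= expr0 bin0 mulr1n.
rewrite [1 + _]addrC addrK.
rewrite big_distrr /=; apply: eq_bigr => i _.
by rewrite /bump /= add1n exprS -[RHS]mulr_natl mulrCA.
Qed.

(** Over the rationals an irreducible [q] either divides [f] or is coprime to it; coprimality
    survives in [F] and excludes a common root. *)
Lemma root_irreducible_int_dvdp (F : numFieldType) (q f : {poly int}) (z : F) :
  irreducible_poly q -> root (map_poly intr q) z -> root (map_poly intr f) z ->
  q %| f.
Proof.
move=> /irreducible_rat_int iq rq rf; rewrite -dvdp_rat_int -[_ %| _]negbK.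
apply/negP; rewrite -irreducible_poly_coprime //.
rewrite -(coprimep_map (ratr : rat -> F)).
have E (g : {poly int}) :
    map_poly (ratr : rat -> F) (map_poly intr g) = map_poly intr g.
  by rewrite -map_poly_comp; apply: eq_map_poly => c /=; rewrite ratr_int.
rewrite !E => /coprimep_root /(_ rq); rewrite -/(root _ z) => /negP; exact.
Qed.

(** Since [z - 1] is a root of both the shifted cyclotomic polynomial and [f(X + 1)], the former
    divides the latter, with an integral quotient because it is monic. At 0 the divisor takes the
    value [p] and the dividend the value [f(1)]. *)
Lemma root_unity_prime_dvd (F : numFieldType) (p : nat) (z : F)
    (f : {poly int}) :
  prime p -> z != 1 -> z ^+ p = 1 -> root (map_poly intr f) z ->
  (p %| f.[1])%Z.
Proof.
move=> pp z1 zp rf; have p0 := prime_gt0 pp.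
have rq : root (map_poly intr (shifted_cyclotomic p)) (z - 1).
  have /eqP := horner_shifted_cyclotomic p (z - 1).
  by rewrite subrK zp subrr mulf_eq0 subr_eq0 (negPf z1).
have rg : root (map_poly intr (f \Po ('X + 1))) (z - 1).
  rewrite map_comp_poly rmorphD /= map_polyX rmorph1 root_comp.
  by rewrite !hornerE subrK.
have := root_irreducible_int_dvdp (irreducible_shifted_cyclotomic pp) rq rg.
case/(Pdiv.IdomainMonic.dvdpP (monic_shifted_cyclotomic p0)) => h.
move/(congr1 (fun g => g.[0])).
rewrite horner_comp !hornerE => ->.
rewrite !horner_coef0 coef_poly p0 bin1; exact: dvdz_mull.
Qed.

(** * Exponential sums *)

Section Expi.
Variable R : realType.
Implicit Types x y t : R.

Definition expi x : R[i] := (cos x +i* sin x)%C.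

Lemma expi0 : expi 0 = 1.
Proof. by rewrite /expi cos0 sin0. Qed.

Lemma expiD x y : expi (x + y) = expi x * expi y.
Proof. by rewrite /expi cosD sinD; congr (_ +i* _)%C; rewrite addrC. Qed.

Lemma expi_sum (I : finType) (F : I -> R) :
  expi (\sum_i F i) = \prod_i expi (F i).
Proof. exact: (big_morph expi expiD expi0). Qed.

Lemma expiMn x n : expi (x *+ n) = expi x ^+ n.
Proof. by elim: n => [|n IH]; rewrite ?expi0 // mulrS exprS expiD IH. Qed.

Lemma norm_expi x : `|expi x| = 1.
Proof. by rewrite normc_def /= cos2Dsin2 sqrtr1. Qed.

Lemma expi_neq0 x : expi x != 0.
Proof. by rewrite -normr_eq0 norm_expi oner_eq0. Qed.

Lemma expiN x : expi (- x) = (expi x)^-1.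
Proof.
by apply: (mulfI (expi_neq0 x)); rewrite mulfV ?expi_neq0 // -expiD subrr expi0.
Qed.

Lemma expiB x y : expi (x - y) = expi x / expi y.
Proof. by rewrite expiD expiN. Qed.

(** The bound places [|x|] in [[0, pi]], where cosine is injective. *)
Lemma expi_eq1 x : `|x| <= 1 -> expi x = 1 -> x = 0.
Proof.
move=> x1 [cx _]; apply/eqP; rewrite -normr_eq0; apply/eqP.
have pi2 := pi_ge2 R.
apply: (@cos_inj R).
- by rewrite in_itv /= normr_ge0 /=; lra.
- by rewrite in_itv /= lexx /=; lra.
- by rewrite cos0; case: (ger0P x) => _; rewrite ?cosN.
Qed.

Lemma expi_inj_small x y : `|x - y| <= 1 -> expi x = expi y -> x = y.
Proof.
move=> xy e; apply/eqP; rewrite -subr_eq0; apply/eqP/expi_eq1 => //.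
by rewrite expiB e mulfV // expi_neq0.
Qed.

End Expi.

(** * Coefficients of exponential sums by averaging *)

Section Averages.
Variable R : realType.

(** Divide by [K] and let [K] grow: the constant [b] disappears. *)
Lemma ler_of_ler_mulrn_add (s m b : R) :
  (forall K : nat, s *+ K <= m *+ K + b) -> s <= m.
Proof.
move=> H; rewrite leNgt; apply/negP => ms.
have d0 : 0 < s - m by rewrite subr_gt0.
have := truncnS_gt (b / (s - m)); rewrite ltr_pdivrMr //.
move: (H (Num.trunc (b / (s - m))).+1); set K := (_.+1).
rewrite -[s *+ K]mulr_natl -[m *+ K]mulr_natl [_ * (s - m)]mulrC mulrBl.
by rewrite ![K%:R * _]mulrC; lra.
Qed.

Lemma norm_geometric_sum_le (F : numFieldType) (y : F) (K : nat) :
  `|y| = 1 -> y != 1 -> `|\sum_(k < K) y ^+ k| <= 2 / `|y - 1|.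
Proof.
move=> ny y1; have d0 : 0 < `|y - 1| by rewrite normr_gt0 subr_eq0.
rewrite ler_pdivlMr // -normrM mulrC -subrX1.
by apply: (le_trans (ler_normB _ _)); rewrite normrX ny expr1n normr1.
Qed.

(** Divide the [k]-th sum by [z i0 ^+ k] and add over [k < K]. The indices with [z i = z i0]
    contribute [K] times the wanted sum, the others geometric sums bounded independently of [K]. *)
Lemma norm_coef_le_of_exp_sum_le (I : finType) (w z : I -> R[i]) (M : R) i0 :
  (forall i, `|z i| = 1) ->
  (forall k : nat, `|\sum_i w i * z i ^+ k| <= M%:C%C) ->
  `|\sum_(i | z i == z i0) w i| <= M%:C%C.
Proof.
move=> nz H; set S := \sum_(i | _) _.
have z0 i : z i != 0 by rewrite -normr_eq0 nz oner_eq0.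
pose y i := z i / z i0.
have ny i : `|y i| = 1 by rewrite normrM normfV !nz invr1 mulr1.
have y1 i : (y i == 1) = (z i == z i0).
  by rewrite -[1](mulfV (z0 i0)) (inj_eq (mulIf _)) // invr_eq0.
have Hy k : `|\sum_i w i * y i ^+ k| <= M%:C%C.
  apply: le_trans (H k).
  have -> : \sum_i w i * y i ^+ k = (\sum_i w i * z i ^+ k) * z i0 ^- k.
    rewrite big_distrl /=; apply: eq_bigr => i _.
    by rewrite exprMn exprVn mulrA.
  by rewrite normrM normfV normrX nz expr1n invr1 mulr1.
(* [B] bounds the contribution of all ratios [y i] other than 1, uniformly in [K]. *)
pose B := \sum_(i | z i != z i0) `|w i| * (2 / `|y i - 1|).
have key K : `|S| *+ K <= M%:C%C *+ K + B.
  have -> : `|S| *+ K = `|\sum_(k < K) (\sum_i w i * y i ^+ k)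
      - \sum_(i | z i != z i0) w i * \sum_(k < K) y i ^+ k|.
    rewrite -normrMn; congr (`| _ |).
    rewrite exchange_big /= (bigID (fun i => z i == z i0)) /=.
    rewrite [X in _ + X - _](_ : _ =
      \sum_(i | z i != z i0) w i * \sum_(k < K) y i ^+ k);
      last by apply: eq_bigr => i _; rewrite big_distrr.
    rewrite addrK /S -sumrMnl; apply: eq_bigr => i; rewrite -y1 => /eqP ->.
    under eq_bigr do rewrite expr1n mulr1.
    by rewrite sumr_const card_ord.
  apply: (le_trans (ler_normB _ _)); apply: lerD.
    apply: (le_trans (ler_norm_sum _ _ _)).
    rewrite -[K in _ <= _ *+ K]card_ord -sumr_const.
    by apply: ler_sum => k _; exact: Hy.
  apply: (le_trans (ler_norm_sum _ _ _)).
  apply: ler_sum => i; rewrite -y1 => yi1.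
  by rewrite normrM ler_wpM2l // norm_geometric_sum_le.
have [s Es] : exists s : R, `|S| = s%:C%C by exact/complex_realP/normr_real.
have [b Eb] : exists b : R, B = b%:C%C.
  apply/complex_realP/ger0_real/sumr_ge0 => i _.
  by rewrite mulr_ge0 // divr_ge0.
rewrite Es lecR; apply: (@ler_of_ler_mulrn_add _ _ b) => K.
by have := key K; rewrite Es Eb -!rmorphMn -rmorphD lecR.
Qed.

(** For [q > 0], write [q = exp(-y)] and [t = y / (m + 1)]. Once [exp(t N) > N + 1], raising to the
    power [m + 1] gives [(N + 1)^m < exp(y N) = q^(-N)]. *)
Lemma exists_poly_geometric_lt1 (m : nat) (q : R) : 0 <= q -> q < 1 ->
  exists N : nat, N.+1%:R ^+ m * q ^+ N < 1.
Proof.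
rewrite le_eqVlt => /orP[/eqP <- _|q0 q1].
  by exists 1%N; rewrite expr1 mulr0.
pose y := - ln q; have y0 : 0 < y by rewrite oppr_gt0 ln_lt0 // q0 q1.
pose t := y / m.+1%:R; have t0 : 0 < t by rewrite divr_gt0.
(* This makes [(t N)^2 / 2 > N], so the quadratic term of the exponential series already
   suffices. *)
pose N := (Num.trunc (2 / t ^+ 2)).+1.
have N0 : 0 < N%:R :> R by rewrite ltr0n.
have NE : N.+1%:R < expR (t *+ N).
  apply: lt_le_trans (expR_ge1Dxn 1 (mulrn_wge0 _ (ltW t0))).
  rewrite -natr1 addrC ltrD2l -[t *+ N]mulr_natr exprMn.
  have := truncnS_gt (2 / t ^+ 2); rewrite -/N ltr_pdivrMr ?exprn_gt0 //.
  rewrite [(2)`!]/= => h; rewrite ltr_pdivlMr ?ltr0n // [N%:R ^+ 2]expr2.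
  by rewrite [N%:R * 2]mulrC mulrA ltr_pM2r // mulrC.
exists N; have -> : q = expR (- y) by rewrite opprK lnK.
rewrite -expRM_natl mulr_natl mulNrn expRN.
rewrite ltr_pdivrMr ?expR_gt0 // mul1r.
apply: (@le_lt_trans _ _ (N.+1%:R ^+ m.+1)).
  by apply: ler_weXn2l => //; rewrite ler1n.
apply: (@lt_le_trans _ _ (expR (t *+ N) ^+ m.+1)).
  by rewrite ltrXn2r // ?ler0n ?nnegrE ?expR_ge0.
by rewrite -expRM_natl mulrnAr /t mulrCA mulfV ?pnatr_eq0 // mulr1.
Qed.

End Averages.

(** * Kronecker approximation *)

(** On the unit circle [|1 + x|^2 = 4 - |x - 1|^2], which is at most
    [4 - d^2 <= (2 - d^2 / 4)^2]. *)
Lemma norm_1D_le (R : realType) (x : R[i]) (d : R) :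
  `|x| = 1 -> 0 <= d -> d%:C%C <= `|x - 1| -> `|1 + x| <= (2 - d ^+ 2 / 4)%:C%C.
Proof.
case: x => a b; rewrite !normc_def /= => -[] /(congr1 (fun y => y ^+ 2)).
rewrite expr1n sqr_sqrtr ?addr_ge0 ?sqr_ge0 // => ab d0.
rewrite !lecR oppr0 !add0r addr0 => dx.
have dx2 : d ^+ 2 <= (a - 1) ^+ 2 + b ^+ 2.
  rewrite -[leRHS]sqr_sqrtr ?addr_ge0 ?sqr_ge0 //.
  by rewrite lerXn2r // nnegrE // sqrtr_ge0.
have a1 : -1 <= a by have := sqr_ge0 b; nra.
have c0 : 0 <= 2 - d ^+ 2 / 4 by move: a1 dx2 ab; rewrite !expr2; lra.
rewrite -[leRHS](ger0_norm c0) -sqrtr_sqr ler_wsqrtr //.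
by have := sqr_ge0 (d ^+ 2); move: dx2 ab; set D := d ^+ 2; nra.
Qed.

Section Kronecker.
Variables (R : realType) (J : finType).

Lemma sum_ffun_count (V : nmodType) (I : finType) (th : J -> V) (f : I -> J) :
  \sum_i th (f i) = \sum_j th j *+ #|[set i | f i == j]|.
Proof.
rewrite (partition_big f xpredT) //=; apply: eq_bigr => j _.
rewrite (eq_bigr (fun=> th j)); last by move=> i /eqP ->.
by rewrite sumr_const; congr (_ *+ _); apply: eq_card => i; rewrite !inE.
Qed.

Variables (th : J -> R) (c : J -> R[i]) (j0 : J).
Hypotheses (th0 : th j0 = 0) (c0 : c j0 = 1) (norm_c : forall j, `|c j| = 1).
(** Kronecker's condition on integer relations, with the positive and negative terms listed
    separately as words [f] and [g]. The index [j0], of frequency 0 and phase 1, can pad them to a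
    common length. *)
Hypothesis compat : forall N (f g : {ffun 'I_N -> J}),
  \sum_i th (f i) = \sum_i th (g i) -> \prod_i c (f i) = \prod_i c (g i).

(** Bohr's test function: every term has modulus 1, and all terms equal 1 exactly when all phases
    are aligned at [u]. *)
Let G (u : R) : R[i] := \sum_j expi (u * th j) / c j.

Let norm_term u j : `|expi (u * th j) / c j| = 1.
Proof. by rewrite normrM normfV norm_expi norm_c invr1 mulr1. Qed.

(** The term at [j0] is 1 and the term at [j] is at distance at least [d] from 1, so this pair loses
    [d^2 / 4]; each of the other [#|J| - 2] terms has modulus 1. *)
Let G_le (u d : R) j : 0 < d -> d%:C%C <= `|expi (u * th j) - c j| ->
  `|G u| <= (#|J|%:R - d ^+ 2 / 4)%:C%C.
Proof.
move=> d0 dj.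
have cj0 : c j != 0 by rewrite -normr_eq0 norm_c oner_eq0.
have jj0 : j != j0.
  apply/eqP => e; move: dj; rewrite e th0 mulr0 c0 expi0 subrr normr0.
  by rewrite lecR leNgt d0.
rewrite /G (bigD1 j0) //= (bigD1 j) //= th0 mulr0 c0 expi0 divr1 addrA.
apply: (le_trans (ler_normD _ _)).
have -> : #|J|%:R - d ^+ 2 / 4 = (2 - d ^+ 2 / 4) + (#|J|.-2)%:R :> R.
  have J2 : (1 < #|J|)%N.
    by apply/card_gt1P; exists j, j0.
  rewrite -{1}(subnKC J2) natrD -subn2; ring.
rewrite rmorphD; apply: lerD.
  apply: norm_1D_le (ltW d0) _; first exact: norm_term.
  by rewrite -[1](mulfV cj0) -mulrBl normrM normfV norm_c invr1 mulr1.
apply: (le_trans (ler_norm_sum _ _ _)).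
rewrite (eq_bigr (fun=> 1)); last by move=> i _; exact: norm_term.
rewrite sumr_const rmorph_nat ler_nat.
rewrite (eq_card (B := ~: [set j0; j])); last by move=> i; rewrite !inE negb_or.
by rewrite cardsCs finset.setCK cards2 eq_sym jj0 subn2.
Qed.

Let freq N (f : {ffun 'I_N -> J}) := \sum_i th (f i).

(** Expand [G ^+ N] over words of length [N]. By [compat], words of equal frequency carry equal
    coefficients of modulus 1, so their joint coefficient has their number as modulus; averaging
    bounds it by [M ^+ N]. *)
Let card_freq_le (T M : R) N (f0 : {ffun 'I_N -> J}) : 0 <= M ->
  (forall u, T <= u -> `|G u| <= M%:C%C) ->
  #|[set f : {ffun 'I_N -> J} | freq f == freq f0]|%:R <= M ^+ N.
Proof.
move=> M0 GM.
pose H := \sum_j `|th j|.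
have thH j : `|th j| <= H by rewrite /H (bigD1 j) //= lerDl sumr_ge0.
have freqH f : `|@freq N f| <= N%:R * H.
  apply: (le_trans (ler_norm_sum _ _ _)).
  rewrite mulr_natl -[N in _ *+ N]card_ord -sumr_const.
  by apply: ler_sum.
have H0 : 0 <= H by rewrite sumr_ge0.
have D0 : 0 < 1 + 2 * (N%:R * H).
  by have := mulr_ge0 (ler0n R N) H0; lra.
(* Sampling step: [h] times a difference of two frequencies is at most 1 in absolute value, so
   distinct frequencies keep distinct values [z]. *)
pose h := (1 + 2 * (N%:R * H))^-1.
have h0 : 0 < h by rewrite invr_gt0.
pose w (f : {ffun 'I_N -> J}) := expi (T * freq f) / \prod_i c (f i).
pose z (f : {ffun 'I_N -> J}) := expi (h * freq f).
have nw f : `|w f| = 1.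
  rewrite normrM norm_expi normfV normr_prod big1 ?invr1 ?mulr1 //.
have GN k : G (T + h *+ k) ^+ N = \sum_f w f * z f ^+ k.
  rewrite -[N in LHS]card_ord -prodr_const /G bigA_distr_bigA /=.
  apply: eq_bigr => f _; rewrite prodf_div /w mulrAC; congr (_ / _).
  rewrite -expi_sum -expiMn -expiD -mulrnAl -mulrDl; congr expi.
  by rewrite /freq big_distrr.
have := @norm_coef_le_of_exp_sum_le R _ w z (M ^+ N) f0.
have zE f : (z f == z f0) = (freq f == freq f0).
  apply/eqP/eqP => [|e]; last by rewrite /z e.
  move/expi_inj_small => e; apply: (mulfI (lt0r_neq0 h0)); apply: e.
  rewrite -mulrBr normrM gtr0_norm // mulrC ler_pdivrMr // mul1r.
  apply: (le_trans (ler_normB _ _)).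
  by have := freqH f; have := freqH f0; lra.
have -> : \sum_(f | z f == z f0) w f =
    w f0 *+ #|[set f : {ffun 'I_N -> J} | freq f == freq f0]|.
  rewrite -sumr_const; apply: eq_big => f; first by rewrite !inE zE.
  by rewrite zE => /eqP e; rewrite /w e (compat e).
rewrite normrMn nw rmorphXn -(rmorph_nat (real_complex R)).
rewrite -rmorphXn lecR; apply; first by move=> f; exact: norm_expi.
move=> k; rewrite -GN normrX rmorphXn lerXn2r ?nnegrE //.
  by rewrite lecR.
by apply: GM; rewrite lerDl mulrn_wge0 // ltW.
Qed.

(** The frequency of a word depends only on the multiplicities of its letters. There are at most
    [(N + 1)^#|J|] multiplicity vectors, and each is shared by at most [M ^+ N] of the [#|J| ^ N]
    words. *)
Let card_pow_le (T M : R) N : 0 <= M ->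
  (forall u, T <= u -> `|G u| <= M%:C%C) ->
  #|J|%:R ^+ N <= N.+1%:R ^+ #|J| * M ^+ N.
Proof.
move=> M0 GM.
(* A multiplicity is at most [N], so [inord] preserves it. *)
pose cnt (f : {ffun 'I_N -> J}) : {ffun J -> 'I_N.+1} :=
  [ffun j => inord #|[set i | f i == j]|].
have cntE f g : cnt f = cnt g -> freq f = freq g.
  move=> e; rewrite /freq !sum_ffun_count; apply: eq_bigr => j _.
  have /(congr1 val) := congr1 (fun v : {ffun J -> 'I_N.+1} => v j) e.
  rewrite !ffunE /= !inordK ?ltnS.
  - by move=> ->.
  - by rewrite -[leqRHS]card_ord max_card.
  - by rewrite -[leqRHS]card_ord max_card.
have -> : #|J|%:R ^+ N = \sum_(f : {ffun 'I_N -> J}) 1 :> R.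
  by rewrite sumr_const card_ffun card_ord -natrX.
rewrite (partition_big cnt xpredT) //.
have -> : N.+1%:R ^+ #|J| * M ^+ N = \sum_(v : {ffun J -> 'I_N.+1}) M ^+ N.
  by rewrite sumr_const card_ffun card_ord -[RHS]mulr_natl natrX.
apply: ler_sum => v _; rewrite sumr_const.
have [f0 /eqP f0v|nov] := pickP (fun f => cnt f == v); last first.
  by rewrite eq_card0 ?exprn_ge0.
apply: le_trans (card_freq_le f0 M0 GM).
rewrite ler_nat; apply: subset_leq_card; apply/fintype.subsetP => f.
by move=> fv; rewrite inE; apply/eqP/cntE; rewrite f0v; exact/eqP.
Qed.

(* Bohr's argument: if the phases never align, then [|G|] stays below
   [#|J| - d^2/4], whereas some coefficient of [G ^+ N] is at least
   [#|J| ^ N / (N + 1) ^ #|J|]. *)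
Lemma kronecker_approx (T d : R) : 0 < d ->
  exists2 u, T <= u & forall j, `|expi (u * th j) - c j| < d%:C%C.
Proof.
move=> d0; apply: contrapT => no.
pose M : R := #|J|%:R - d ^+ 2 / 4.
have GM u : T <= u -> `|G u| <= M%:C%C.
  move=> Tu; have [j dj] : exists j, d%:C%C <= `|expi (u * th j) - c j|.
    apply: contrapT => noj; apply: no; exists u => // j.
    have dr : d%:C%C \is Num.real by apply/complex_realP; exists d.
    rewrite real_ltNge ?normr_real //.
    by apply/negP => dj; apply: noj; exists j.
  exact: G_le dj.
have M0 : 0 <= M by rewrite -ler0c; apply: le_trans (GM T (lexx T)).
have J0 : 0 < #|J|%:R :> R by rewrite ltr0n; apply/card_gt0P; exists j0.
have [||N] := @exists_poly_geometric_lt1 R #|J| (M / #|J|%:R).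
- by rewrite divr_ge0 // ltW.
- by rewrite ltr_pdivrMr // mul1r /M; have := exprn_gt0 2 d0; lra.
rewrite exprMn exprVn mulrA ltr_pdivrMr ?exprn_gt0 // mul1r.
by rewrite ltNge (card_pow_le N M0 GM).
Qed.

End Kronecker.

(** * Spectrum of the cycle *)

Section RootOfUnity.
Variables (R : realType) (p : nat).
Hypotheses (p_pr : prime p) (p_odd : odd p).

Let p_gt0 : (0 < p)%N := prime_gt0 p_pr.
Let p_gt2 : (2 < p)%N := odd_prime_gt2 p_odd p_pr.

Definition cyc_root : R[i] := expi (2 * pi / p%:R).
Definition cyc_eig (k : nat) : R := 2 * cos (2 * pi / p%:R *+ k).
Local Notation w := cyc_root.

Lemma norm_cyc_root : `|w| = 1.
Proof. exact: norm_expi. Qed.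

Lemma cyc_rootX : w ^+ p = 1.
Proof.
have -> : w ^+ p = expi (pi *+ 2).
  rewrite -expiMn; congr expi.
  by rewrite -[LHS]mulr_natr mulfVK ?mulr_natl // pnatr_eq0 -lt0n.
by rewrite /expi cos2pi sin2pi.
Qed.

Lemma cyc_root_neq1 : w != 1.
Proof.
apply/eqP => -[c1 _]; have pi0 := pi_gt0 R.
have p0 : 0 < p%:R :> R by rewrite ltr0n.
have x0 : 0 < 2 * pi / p%:R :> R by rewrite divr_gt0 // mulr_gt0.
suff : 2 * pi / p%:R = 0 :> R by move/eqP; rewrite gt_eqF.
apply: (@cos_inj R); rewrite ?cos0 // in_itv /= ?lexx ?(ltW pi0) ?(ltW x0) //=.
rewrite ler_pdivrMr // mulrC ler_pM2l //.
by rewrite (ler_nat _ 2); exact: ltnW.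
Qed.

Lemma cyc_root_prim : p.-primitive_root w.
Proof.
have [m pm mp] := prim_order_exists p_gt0 cyc_rootX.
have /primeP[_ /(_ _ mp)/pred2P[m1|<-//]] := p_pr.
have := prim_expr_order pm; rewrite m1 expr1 => /eqP.
by rewrite (negPf cyc_root_neq1).
Qed.

Lemma cyc_eigE k : (cyc_eig k)%:C%C = w ^+ k + w ^- k.
Proof.
rewrite -expiMn -expiN /expi cosN sinN /cyc_eig; set x := _ *+ k.
by rewrite /= /real_complex_def; congr (_ +i* _)%C; rewrite ?subrr //; ring.
Qed.

(** [None] is the reference index of frequency 0 and phase 1; every eigenvalue has target phase
    [w]. *)
Let th (j : option 'I_p) : R := if j is Some k then cyc_eig k else 0.
Let phase (j : option 'I_p) : R[i] := w ^+ isSome j.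

Lemma cyc_eig_compat N (f g : {ffun 'I_N -> option 'I_p}) :
  \sum_i th (f i) = \sum_i th (g i) ->
  \prod_i phase (f i) = \prod_i phase (g i).
Proof.
move=> fg; rewrite !prodrXr.
set nf := (\sum_i isSome (f i))%N; set ng := (\sum_i isSome (g i))%N.
(* [X^(p - k)] stands for the negative power [w^-k]. The value at 1 is 2 for every [k], including
   [k = 0]. *)
pose F (j : option 'I_p) : {poly int} := 
  if j is Some k then 'X^k + 'X^(p - k) else 0.
have Fw j : (map_poly intr (F j)).[w] = (th j)%:C%C.
  case: j => [k|] /=; last by rewrite rmorph0 horner0.
  rewrite rmorphD /= !map_polyXn !hornerE cyc_eigE; congr (_ + _).
  have wk : w ^+ k != 0 by rewrite expf_neq0 // expi_neq0.
  by apply: (mulfI wk); rewrite mulfV // -exprD subnKC ?cyc_rootX // ltnW.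
have F1 j : (F j).[1] = (2 * isSome j)%:Z.
  by case: j => [k|] /=; rewrite !hornerE ?expr1n.
have sumF (h : {ffun 'I_N -> option 'I_p}) :
    (map_poly intr (\sum_i F (h i))).[w] = (\sum_i th (h i))%:C%C.
  by rewrite !rmorph_sum /= horner_sum; apply: eq_bigr => i _; rewrite Fw.
have sum1 (h : {ffun 'I_N -> option 'I_p}) :
    (\sum_i F (h i)).[1] = (2 * \sum_i isSome (h i))%N%:Z.
  rewrite horner_sum big_distrr /= (big_morph Posz PoszD (erefl 0%:Z)).
  by apply: eq_bigr => i _; rewrite F1.
have := @root_unity_prime_dvd _ p w (\sum_i F (f i) - \sum_i F (g i)) p_pr
  cyc_root_neq1 cyc_rootX.
rewrite rmorphB rootE hornerD hornerN !sumF fg subrr eqxx => /(_ isT).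
rewrite hornerD hornerN !sum1 -/nf -/ng => dvd.
suff e : nf = ng %[mod p].
  by rewrite -(expr_mod nf cyc_rootX) e expr_mod // cyc_rootX.
apply/eqP; move: dvd; rewrite !PoszM -mulrBr.
rewrite Gauss_dvdzr ?coprimezE ?coprimen2 //.
by rewrite -eqz_mod_dvd !modz_nat.
Qed.

Lemma cyc_kronecker (T d : R) : 0 < d ->
  exists2 u, T <= u &
    forall k : 'I_p, `|expi (u * cyc_eig k) - w| < d%:C%C.
Proof.
move=> d0.
have norm_phase j : `|phase j| = 1 by rewrite normrX norm_expi expr1n.
have [u Tu h] := @kronecker_approx R _ th phase None erefl erefl norm_phase
  cyc_eig_compat T d d0.
by exists u => // k; exact: h (Some k).
Qed.

(** Orthogonality of characters: for [a] and [b] distinct, the ratio [y] is a [p]-th root of unity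
    other than 1, so its geometric sum vanishes. *)
Lemma sum_cyc_root (a b : 'I_p) :
  \sum_(k < p) (w ^+ a / w ^+ b) ^+ k = p%:R * (a == b)%:R.
Proof.
have w0 n : w ^+ n != 0 by rewrite expf_neq0 // expi_neq0.
have [->|ab] := eqVneq a b.
  rewrite mulfV // mulr1; under eq_bigr do rewrite expr1n.
  by rewrite sumr_const card_ord.
set y := _ / _; rewrite mulr0.
have y1 : y - 1 != 0.
  rewrite subr_eq0 /y -[1](mulfV (w0 b)) (inj_eq (mulIf _)) ?invr_eq0 //.
  rewrite (eq_prim_root_expr cyc_root_prim) !modn_small //.
have yp : y ^+ p = 1.
  rewrite exprMn exprVn -!exprM ![(_ * p)%N]mulnC !exprM.
  by rewrite cyc_rootX !expr1n divr1.
by apply: (mulfI y1); rewrite mulr0 -subrX1 yp subrr.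
Qed.

Lemma cycle_adjE (a j : 'I_p) :
  cycle_adj R p a j = (j == ordS a)%:R + (j == ord_pred a)%:R.
Proof.
have -> : cycle_adj R p a j = ((j == ordS a) || (j == ord_pred a))%:R.
  rewrite mxE; congr (_ || _)%:R; rewrite -[X in _ = (j == X)]/(ord_pred a).
  by rewrite -[in RHS](inj_eq (can_inj (@ordSK p))) ord_predK eq_sym.
have [->|//] := eqVneq j (ordS a); last by rewrite add0r.
(* The two neighbours differ because [a + 2] is not [a] modulo [p > 2]; hence the disjunction is a
   sum. *)
suff /negPf -> : ordS a != ord_pred a by rewrite addr0.
rewrite -(inj_eq (can_inj (@ordSK p))) ord_predK -val_eqE /=.
rewrite -addn1 modnDml addn1 -{2}[val a](modn_small (ltn_ord a)) -addn2.
by rewrite -{2}[val a]addn0 eqn_modDl mod0n modn_small.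
Qed.

Lemma cycle_adj_eigen (a : 'I_p) (k : nat) :
  \sum_j cycle_adj R p a j * w ^+ (j * k) = (cyc_eig k)%:C%C * w ^+ (a * k).
Proof.
under eq_bigr do rewrite cycle_adjE mulrDl.
rewrite big_split /= (bigD1 (ordS a)) //= big1 ?addr0; last first.
  by move=> j /negPf ->; rewrite mul0r.
rewrite [X in _ + X](bigD1 (ord_pred a)) //.
rewrite [X in _ + (_ + X)]big1 ?addr0; last first.
  by move=> j /negPf ->; rewrite mul0r.
rewrite !eqxx !mul1r cyc_eigE mulrDl.
have wp n : w ^+ (n %% p * k) = w ^+ (n * k).
  rewrite ![(_ * k)%N]mulnC !exprM.
  by apply: expr_mod; rewrite -exprM mulnC exprM cyc_rootX expr1n.
congr (_ + _); first by rewrite /= wp mulSn exprD.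
rewrite -[a in RHS]ord_predK; move: (ord_pred a) => b.
rewrite /= wp mulSn exprD mulrA mulVf ?mul1r //.
by rewrite expf_neq0 // expi_neq0.
Qed.

(** Spectral decomposition in the Fourier basis, by induction: orthogonality gives [n = 0] and the
    eigenvector equation gives the step. *)
Lemma cycle_adjX (a b : 'I_p) n :
  (cycle_adj R p ^+ n) a b =
  p%:R^-1 * \sum_(k < p) (w ^+ a / w ^+ b) ^+ k * (cyc_eig k)%:C%C ^+ n.
Proof.
elim: n a => [|n IH] a.
  rewrite expr0 -/(1%:M) mxE.
  under eq_bigr do rewrite mulr1.
  by rewrite sum_cyc_root mulKf // pnatr_eq0 -lt0n.
rewrite exprS -mulmxE mxE; under eq_bigr do rewrite IH mulrCA.
rewrite -big_distrr /=; congr (_ * _).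
under eq_bigr do rewrite big_distrr /=.
rewrite exchange_big /=; apply: eq_bigr => k _.
have E (c : 'I_p) : (w ^+ c / w ^+ b) ^+ k = w ^+ (c * k) / w ^+ (b * k).
  by rewrite exprMn exprVn -!exprM.
transitivity (\sum_i cycle_adj R p a i * w ^+ (i * k)
              * ((cyc_eig k)%:C%C ^+ n / w ^+ (b * k))).
  by apply: eq_bigr => i _; rewrite E; ring.
rewrite -big_distrl /= cycle_adj_eigen E exprS; ring.
Qed.

End RootOfUnity.

Local Open Scope classical_set_scope.

(** * Exponential of the adjacency matrix *)

Section MatrixTopology.
Variables (T : topologicalType) (m n : nat).

(** Uniqueness of limits identifies the [lim] in [expmx] from a convergence proof. *)
Lemma matrix_hausdorff : hausdorff_space T -> hausdorff_space 'M[T]_(m, n).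
Proof.
move=> hT A B AB; apply/matrixP => i j; apply: hT => P Q AP BQ.
have nb (C : 'M[T]_(m, n)) (S : set T) : nbhs (C i j) S ->
    nbhs C [set D : 'M[T]_(m, n) | S (D i j)].
  move=> CS; exists (fun i' j' => if (i' == i) && (j' == j) then S else setT).
    move=> i' j'; case: ifPn => [/andP[/eqP -> /eqP -> //]|_]; exact: filterT.
  by move=> D /(_ i j); rewrite !eqxx.
by have [D [PD QD]] := AB _ _ (nb A P AP) (nb B Q BQ); exists (D i j).
Qed.

Lemma cvg_matrix (U : Type) (F : set_system U) {FF : Filter F}
    (f : U -> 'M[T]_(m, n)) (A : 'M[T]_(m, n)) :
  (forall i j, (fun u => f u i j) @ F --> A i j) -> f @ F --> A.
Proof.
move=> fA S [P AP PS]; rewrite /nbhs /= /fmap.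
apply: (@filterS _ _ _ (fun u => forall i j, P i j (f u i j))).
  by move=> u Pu; apply: PS.
apply: filter_forall => i; apply: filter_forall => j.
exact: fA (AP i j).
Qed.

End MatrixTopology.

Lemma cvg_sumr (K : numFieldType) (V : normedModType K) (I : finType)
    (f : I -> nat -> V) (l : I -> V) :
  (forall i, f i @ \oo --> l i) ->
  (fun N => \sum_i f i N) @ \oo --> \sum_i l i.
Proof.
move=> fl; rewrite (_ : (fun N => _) = \sum_i f i); last first.
  by apply/funext => N; rewrite fct_sumE.
apply: (big_ind2 (fun (g : nat -> V) (a : V) => g @ \oo --> a)) => //.
  exact: cvg_cst.
by move=> g a g' a'; exact: cvgD.
Qed.

(** * The exponential series on the imaginary axis *)

Section ExpiSeries.
Variable R : realType.

Lemma cvg_complex (u v : nat -> R) (a b : R) :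
  u @ \oo --> a -> v @ \oo --> b ->
  (fun N => (u N +i* v N)%C : cplx R) @ \oo --> ((a +i* b)%C : cplx R).
Proof.
move=> ua vb; apply/cvgrPdist_lt => e e0.
have [r Er] : exists r : R, e = r%:C%C by exact/complex_realP/gtr0_real.
have r0 : 0 < r by move: e0; rewrite Er -(ltcR 0).
have r2 : 0 < r / 2 by rewrite divr_gt0.
move/cvgrPdist_lt/(_ _ r2): ua => ua; move/cvgrPdist_lt/(_ _ r2): vb => vb.
near=> N.
have uN : `|a - u N| < r / 2 by near: N.
have vN : `|b - v N| < r / 2 by near: N.
rewrite Er normc_def ltcR /=.
apply: (@le_lt_trans _ _ (`|a - u N| + `|b - v N|)); last by lra.
rewrite -[leRHS]ger0_norm ?addr_ge0 // -sqrtr_sqr ler_wsqrtr //.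
rewrite -[X in X + _]real_normK ?num_real //.
rewrite -[X in _ + X]real_normK ?num_real //.
have := normr_ge0 (a - u N); have := normr_ge0 (b - v N); nra.
Unshelve. all: by end_near. Qed.

(** Reconciles the sign exponent of [sin_coeff] with that of [iCX]. *)
Lemma half_pred n : odd n -> n.-1./2 = n./2.
Proof. by case: n => //= n; rewrite uphalf_half => /negPf ->. Qed.

Lemma iCX n :
  iC R ^+ n =
  (((~~ odd n)%:R * (-1) ^+ n./2) +i* ((odd n)%:R * (-1) ^+ n./2))%C.
Proof.
have iM (c s : R) : iC R * (c +i* s)%C = ((- s) +i* c)%C.
  transitivity ((0 * c - 1 * s) +i* (0 * s + 1 * c))%C; first by [].
  by rewrite !mul0r !mul1r !add0r.
elim: n => [|n IH]; first by rewrite !mulr1.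
rewrite exprS IH iM /= uphalf_half.
by case: (odd n); congr (_ +i* _)%C; rewrite /= ?exprS; ring.
Qed.

Lemma expi_partial_sum (x : R) N :
  \sum_(k < N) (k`!%:R)^-1 * (iC R * x%:C%C) ^+ k
  = ((series (cos_coeff x) N) +i* (series (sin_coeff x) N))%C.
Proof.
rewrite /series /= !big_mkord.
elim: N => [|N IH]; first by rewrite !big_ord0.
rewrite !big_ord_recr /= IH.
set c := \sum_(k < N) _; set s := \sum_(k < N) _.
suff -> : (N`!%:R)^-1 * (iC R * x%:C%C) ^+ N
  = ((cos_coeff x N) +i* (sin_coeff x N))%C by [].
have -> : (N`!%:R)^-1 * (iC R * x%:C%C) ^+ N
    = (x ^+ N / N`!%:R)%:C%C * iC R ^+ N.
  by rewrite exprMn rmorphM rmorphXn fmorphV rmorph_nat; ring.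
rewrite iCX /cos_coeff /sin_coeff /=; set y := x ^+ N; set d := (_%:R)^-1.
congr (_ +i* _)%C; first by rewrite -exprnP; ring.
case: (boolP (odd N)) => oN; last by rewrite /=; ring.
by rewrite half_pred // /=; ring.
Qed.

Lemma cvg_expi (x : R) :
  (fun N => \sum_(k < N) (k`!%:R)^-1 * (iC R * x%:C%C) ^+ k : cplx R) @ \oo
    --> (expi x : cplx R).
Proof.
rewrite (_ : (fun N => _) = (fun N =>
   ((series (cos_coeff x) N) +i* (series (sin_coeff x) N))%C)); last first.
  by apply/funext => N; rewrite expi_partial_sum.
(* Unlocked, [cos] and [sin] are the limits of these series, so only convergence remains. *)
apply: cvg_complex; rewrite unlock.
  exact: is_cvg_series_cos_coeff.
exact: is_cvg_series_sin_coeff.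
Qed.

End ExpiSeries.

Lemma exprmxZ (S : comNzRingType) m (c : S) (A : 'M[S]_m) n :
  (c *: A) ^+ n = c ^+ n *: A ^+ n.
Proof.
elim: n => [|n IH]; first by rewrite !expr0 scale1r.
by rewrite !exprS IH -!mulmxE -scalemxAl -scalemxAr scalerA.
Qed.

Section Walk.
Variables (R : realType) (p : nat).
Hypotheses (p_pr : prime p) (p_odd : odd p).
Local Notation w := (cyc_root R p).

(** By [cycle_adjX], each entry of the partial sums is a fixed combination of partial sums of the
    scalar series for [exp(i t theta_k)]. *)
Lemma walk_entryE (a b : 'I_p) (t : R) :
  walk_entry (cycle_adj R p) a b t =
  p%:R^-1 * \sum_(k < p) (w ^+ a / w ^+ b) ^+ k * expi (t * cyc_eig R p k).
Proof.
pose L := (\matrix_(i, j) (p%:R^-1 * \sum_(k < p) (w ^+ i / w ^+ j) ^+ k *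
  expi (t * cyc_eig R p k))) : 'M[cplx R]_p.
transitivity (L a b); last by rewrite mxE.
rewrite /walk_entry /expmx; congr (fun_of_matrix _ a b).
apply: cvg_lim; first by apply: matrix_hausdorff; exact: norm_hausdorff.
apply: cvg_matrix => i j; rewrite mxE.
rewrite (_ : (fun N => _) = (fun N => p%:R^-1 *
   \sum_(k < p) (w ^+ i / w ^+ j) ^+ k *
      \sum_(n < N) (n`!%:R)^-1 * (iC R * (t * cyc_eig R p k)%:C%C) ^+ n
      : cplx R)).
  apply: (@cvgMl_tmp R[i]); apply: (@cvg_sumr R[i] (cplx R)) => k.
  by apply: (@cvgMl_tmp R[i]); exact: cvg_expi.
apply/funext => N; rewrite summxE.
transitivity (\sum_(n < N) (n`!%:R)^-1 * (iC R * t%:C%C) ^+ n *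
   (cycle_adj R p ^+ n) i j).
  apply: eq_bigr => n _; by rewrite exprmxZ !mxE mulrA.
under eq_bigr do rewrite cycle_adjX // mulrCA.
rewrite -big_distrr /=; congr (_ * _).
under eq_bigr do rewrite big_distrr /=.
rewrite exchange_big /=; apply: eq_bigr => k _.
rewrite big_distrr /=; apply: eq_bigr => n _.
rewrite [(t * _)%:C%C]rmorphM mulrCA -!mulrA; congr (_ * _).
by rewrite -exprMn -mulrA.
Qed.

End Walk.

(** * Rotation of the curve *)

Section WalkRotation.
Variables (R : realType) (p : nat).
Hypotheses (p_pr : prime p) (p_odd : odd p).
Variables a b : 'I_p.
Local Notation w := (cyc_root R p).
Local Notation walk := (walk_entry (cycle_adj R p) a b).

(** The difference is an average over [k] of unimodular numbers times
    [w - expi (u * cyc_eig R p k)], hence bounded uniformly in [s]. *)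
Lemma walk_shift (s u d : R) :
  (forall k : 'I_p, `|expi (u * cyc_eig R p k) - w| < d%:C%C) ->
  `|w * walk s - walk (s + u)| <= d%:C%C :> R[i].
Proof.
move=> hu; rewrite !walk_entryE //.
have -> : w * (p%:R^-1 * (\sum_(k < p) (w ^+ a / w ^+ b) ^+ k *
              expi (s * cyc_eig R p k))) -
          p%:R^-1 * (\sum_(k < p) (w ^+ a / w ^+ b) ^+ k *
              expi ((s + u) * cyc_eig R p k)) =
  p%:R^-1 * \sum_(k < p) (w ^+ a / w ^+ b) ^+ k * expi (s * cyc_eig R p k)
    * (w - expi (u * cyc_eig R p k)) :> R[i].
  rewrite mulrCA -mulrBr; congr (_ * _); rewrite big_distrr -sumrB /=.
  by apply: eq_bigr => k _; rewrite mulrDl expiD; ring.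
have p0 : 0 < p%:R :> R[i] by rewrite ltr0n prime_gt0.
rewrite normrM normfV (gtr0_norm p0) ler_pdivrMl //.
apply: (le_trans (ler_norm_sum _ _ _)).
rewrite mulr_natl -[p in leRHS]card_ord -sumr_const; apply: ler_sum => k _.
have nw n : `|w ^+ n| = 1 by rewrite normrX norm_cyc_root expr1n.
rewrite 2!normrM normrX normf_div !nw norm_expi divr1 expr1n !mul1r.
by rewrite distrC ltW.
Qed.

(** Multiplication by [w] is an isometry, so the errors of [m] successive shifts add up. With
    [m = p] the factor [w ^+ m] is 1. *)
Lemma walk_shiftMn (s u d : R) m :
  (forall k : 'I_p, `|expi (u * cyc_eig R p k) - w| < d%:C%C) ->
  `|w ^+ m * walk s - walk (s + u *+ m)| <= (d *+ m)%:C%C :> R[i].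
Proof.
move=> hu; elim: m => [|m IH].
  by rewrite !mulr0n addr0 expr0 mul1r subrr normr0.
have -> : w ^+ m.+1 * walk s - walk (s + u *+ m.+1) =
    (w * walk (s + u *+ m) - walk (s + u *+ m + u)) +
    w * (w ^+ m * walk s - walk (s + u *+ m)) :> R[i].
  by rewrite mulrSr addrA exprS mulrBr -mulrA [RHS]addrC addrA subrK.
apply: (le_trans (ler_normD _ _)).
rewrite mulrS rmorphD; apply: lerD; first exact: walk_shift.
by rewrite normrM norm_cyc_root mul1r.
Qed.

End WalkRotation.

(** Balls of [cplx R] have radii in [R[i]]; positive ones are real, so radii from [R] suffice. *)
Lemma closure_cplxP (R : realType) (A : set (cplx R)) (z : cplx R) :
  closure A z <->
  forall e : R, 0 < e -> exists2 y, A y & `|z - y| < e%:C%C :> R[i].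
Proof.
split=> [Az e e0|Az B].
  have /Az : nbhs z (ball z (e%:C%C : R[i])).
    by apply: nbhsx_ballx; rewrite -[0]/(0%:C)%C ltcR.
  by case=> y [Ay]; rewrite -ball_normE => zy; exists y.
move/nbhs_ballP => [e /= e0 eB].
have [r Er] : exists r : R, e = r%:C%C by exact/complex_realP/gtr0_real.
have r0 : 0 < r by move: e0; rewrite Er -(ltcR 0).
have [y Ay zy] := Az _ r0; exists y; split=> //; apply: eB.
by rewrite -ball_normE Er.
Qed.

Theorem theorem4p2 (R : realType) (p : nat) (hp : prime p) (hodd : odd p)
    (a b : 'I_p) :
  exists Reg : set (cplx R),
    (* the curve (t >= 0) lies in Reg *)
    (forall t : R, 0 <= t -> Reg (walk_entry (cycle_adj R p) a b t)) /\
    (* and is dense in Reg as t -> oo: every tail {t >= T} is dense in Reg *)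
    (forall T : R, 0 <= T ->
       Reg `<=` closure [set walk_entry (cycle_adj R p) a b t | t in [set t : R | T <= t]]) /\
    (* Reg has p-fold rotational symmetry about the origin *)
    (forall z : cplx R, Reg z -> Reg (rotC (2 * (pi : R) / p%:R)%R z)).
Proof.
pose walk := walk_entry (cycle_adj R p) a b.
(* The set of limit points at infinity: density of tails holds by definition, leaving membership of
   the curve and rotation. *)
exists [set z | forall T : R, 0 <= T ->
  closure [set walk t | t in [set t : R | T <= t]] z].
split; [|split].
- move=> s s0 T T0; apply/closure_cplxP => e e0.
  have p0 : 0 < p%:R :> R by rewrite ltr0n prime_gt0.
  (* The [p] shifts returning to [walk s] cost at most [e / 2] in total; as [u >= T], the return
     time is beyond [T]. *)
  have d0 : 0 < e / 2 / p%:R by rewrite !divr_gt0.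
  have [u Tu hu] := cyc_kronecker hp hodd T d0.
  exists (walk (s + u *+ p)).
    exists (s + u *+ p) => //=; rewrite -[p]prednK ?prime_gt0 // mulrS.
    have : 0 <= u *+ p.-1 by rewrite mulrn_wge0 // (le_trans T0).
    by lra.
  have := walk_shiftMn hp hodd a b s p hu.
  rewrite cyc_rootX // mul1r => h; apply: le_lt_trans h _.
  by rewrite ltcR -[X in X < _]mulr_natr mulfVK ?gt_eqF //; lra.
- by move=> T T0 z; apply.
- move=> z Rz T T0; apply/closure_cplxP => e e0.
  have e2 : 0 < e / 2 by rewrite divr_gt0.
  have [_ [s Ts <-] zs] := (closure_cplxP _ _).1 (Rz T T0) _ e2.
  (* Already [s >= T], so [u >= 0] keeps the shifted time in the tail. *)
  have [u u0 hu] := cyc_kronecker hp hodd 0 e2.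
  exists (walk (s + u)); first by exists (s + u) => //=; move: Ts => /=; lra.
  have h := walk_shift hp hodd a b s hu.
  rewrite (_ : rotC _ z - _ = cyc_root R p * (z - walk s) +
    (cyc_root R p * walk s - walk (s + u))); last first.
    by rewrite mulrBr addrA subrK.
  apply: (le_lt_trans (ler_normD _ _)).
  rewrite [X in _ < X](_ : _ = (e / 2)%:C%C + (e / 2)%:C%C); last first.
    by rewrite -rmorphD -splitr.
  by apply: ltr_leD h; rewrite normrM norm_cyc_root mul1r.
Qed.
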